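(* Let $(A,\mu,\alpha,\beta)$ be a BiHom-associative algebra with $\alpha,\beta$ bijective, and let $\psi,\omega:A\to A$ be linear maps such that any two of $\alpha,\beta,\psi,\omega$ commute and $\psi(ab)=\psi(a)\psi(b)$, $\omega(ab)=\omega(a)\omega(b)$ for all $a,b\in A$. Let $r,s\in A\otimes A$ be $\alpha,\beta,\psi,\omega$-invariant, and define linear maps $\delta_r,\delta_s,\Delta:A\to A\otimes A$ by $$\delta_{r}(a)=\alpha^{-1}(a)\triangleright r-r\triangleleft\beta^{-1}(a),\quad \delta_{s}(a)=\alpha^{-1}(a)\triangleright s-s\triangleleft\beta^{-1}(a),\quad \Delta(a)=\alpha^{-1}(a)\triangleright r-s\triangleleft\beta^{-1}(a).$$ Then $(A,\mu,\delta_{r},\delta_{s},\Delta,\alpha,\beta,\psi,\omega)$ is a quasitriangular covariant BiHom-bialgebra if and only if $$(\omega\otimes\Delta)(r)=r_{13}r_{12}\qquad\text{and}\qquad(\Delta\otimes\psi)(s)=-s_{23}s_{13}.$$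
   Context: $K$ is a field; everything is $K$-linear; elements of $A\otimes A$ are written $r=r^1\otimes r^2$ with summation understood, and juxtaposition of maps denotes composition. A BiHom-associative algebra $(A,\mu,\alpha,\beta)$ is a vector space $A$ with linear maps $\mu:A\otimes A\to A$, $\mu(a\otimes b)=ab$, and $\alpha,\beta:A\to A$ with $\alpha\beta=\beta\alpha$, $\alpha(ab)=\alpha(a)\alpha(b)$, $\beta(ab)=\beta(a)\beta(b)$, $\alpha(a)(bc)=(ab)\beta(c)$. A BiHom-coassociative coalgebra $(A,\Delta,\psi,\omega)$: $\psi\omega=\omega\psi$, $(\psi\otimes\psi)\Delta=\Delta\psi$, $(\omega\otimes\omega)\Delta=\Delta\omega$, $(\Delta\otimes\psi)\Delta=(\omega\otimes\Delta)\Delta$. Actions on $A\otimes A$: $a\triangleright(x\otimes y)=\omega(a)x\otimes\beta(y)$, $(x\otimes y)\triangleleft a=\alpha(x)\otimes y\psi(a)$. $r$ is $F$-invariant if $(F\otimes F)(r)=r$. For $r,s\in A\otimes A$ (independent copies if equal): $r_{12}s_{23}=\alpha(r^{1})\otimes r^{2}s^{1}\otimes\beta(s^{2})$, $\;r_{13}s_{12}=\omega(r^{1})s^{1}\otimes\beta(s^{2})\otimes\alpha\psi(r^{2})$, $\;r_{23}s_{13}=\beta\omega(s^{1})\otimes\alpha(r^{1})\otimes r^{2}\psi(s^{2})$. A BiHom-derivation is a linear map $\delta:A\to A\otimes A$ with $(F\otimes F)\delta=\delta F$ for $F\in\{\alpha,\beta,\psi,\omega\}$ and $\delta(ab)=a\triangleright\delta(b)+\delta(a)\triangleleft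 b$. A covariant BiHom-bialgebra $(A,\mu,\delta_1,\delta_2,\Delta,\alpha,\beta,\psi,\omega)$: $\delta_1,\delta_2$ are BiHom-derivations, $(A,\mu,\alpha,\beta)$ is a BiHom-associative algebra, $(A,\Delta,\psi,\omega)$ is a BiHom-coassociative coalgebra, $\Delta(ab)=\Delta(a)\triangleleft b+a\triangleright\delta_1(b)=a\triangleright\Delta(b)+\delta_2(a)\triangleleft b$ for all $a,b$, each of $\psi,\omega$ commutes with each of $\alpha,\beta$, $(\alpha\otimes\alpha)\Delta=\Delta\alpha$, $(\beta\otimes\beta)\Delta=\Delta\beta$, and $\psi,\omega$ are multiplicative for $\mu$. With $\delta_r,\delta_s,\Delta$ defined from $r,s$ as in the claim, $(A,\mu,\delta_r,\delta_s,\Delta,\alpha,\beta,\psi,\omega)$ is called a quasitriangular covariant BiHom-bialgebra if $(r,s)$ is an associative BiHom-Yang-Baxter pair of weight $(0,0)$, i.e. $r_{13}r_{12}-r_{12}r_{23}+s_{23}r_{13}=0$ and $s_{13}r_{12}-s_{12}s_{23}+s_{23}s_{13}=0$ (it is then a covariant BiHom-bialgebra). *)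

(* Defs.v *)
From HB Require Import structures.
From mathcomp Require Import all_boot all_algebra generic_quotient sesquilinear.
From mathcomp Require Import boolp classical_sets.
Set Implicit Arguments.
Unset Strict Implicit.
Unset Printing Implicit Defensive.
Import GRing.Theory.
Local Open Scope ring_scope.
Local Open Scope quotient_scope.

Reserved Notation "u \ox v" (at level 36, right associativity).

(** Tensor product of two vector spaces of arbitrary dimension: finite formal
    sums of pairs, modulo the congruence for concatenation generated by
    commutativity and the bilinearity relations. *)

Section TensorProduct.
Variables (K : fieldType) (U V : lmodType K).
Implicit Types s t : seq (U * V).

Inductive tensor_rel : seq (U * V) -> seq (U * V) -> Prop :=
| tensor_refl s : tensor_rel s s
| tensor_sym s t : tensor_rel s t -> tensor_rel t s
| tensor_trans s t w : tensor_rel s t -> tensor_rel t w -> tensor_rel s w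
| tensor_cat s s' t t' :
    tensor_rel s s' -> tensor_rel t t' -> tensor_rel (s ++ t) (s' ++ t')
| tensor_catC s t : tensor_rel (s ++ t) (t ++ s)
| tensor_zero v : tensor_rel [:: (0, v)] [::]
| tensor_addl u u' v : tensor_rel [:: (u + u', v)] [:: (u, v); (u', v)]
| tensor_addr u v v' : tensor_rel [:: (u, v + v')] [:: (u, v); (u, v')]
| tensor_bal (k : K) u v : tensor_rel [:: (k *: u, v)] [:: (u, k *: v)].

Definition tensor_relb s t : bool := `[< tensor_rel s t >].

Lemma tensor_relb_refl : reflexive tensor_relb.
Proof. by move=> s; apply/asboolP; exact: tensor_refl. Qed.

Lemma tensor_relb_sym : symmetric tensor_relb.
Proof. by move=> s t; apply/asboolP/asboolP; exact: tensor_sym. Qed.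

Lemma tensor_relb_trans : transitive tensor_relb.
Proof.
by move=> t s w /asboolP st /asboolP tw; apply/asboolP; exact: tensor_trans tw.
Qed.

Canonical tensor_equiv :=
  EquivRel tensor_relb tensor_relb_refl tensor_relb_sym tensor_relb_trans.

Definition tensor := {eq_quot tensor_equiv}.

HB.instance Definition _ := Choice.on tensor.
HB.instance Definition _ := EqQuotient.on tensor.

Lemma tensor_piE s t : tensor_rel s t <-> \pi_tensor s = \pi_tensor t.
Proof.
by split=> [st|/eqmodP/asboolP//]; apply/eqmodP/asboolP.
Qed.

Lemma tensorW (P : tensor -> Prop) : (forall s, P (\pi_tensor s)) -> forall x, P x.
Proof. exact: quotW. Qed.

Lemma tensor_repr_pi s : tensor_rel (repr (\pi_tensor s)) s.
Proof. by apply/tensor_piE; rewrite reprK. Qed.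

Definition scale_pairs (k : K) s := [seq (k *: p.1, p.2) | p <- s].

Lemma scale_pairs_rel k s t :
  tensor_rel s t -> tensor_rel (scale_pairs k s) (scale_pairs k t).
Proof.
elim=> {s t} [s|s t _|s t w _ h1 _ h2|s s' t t' _ h1 _ h2|s t|v|u u' v|u v v'|l u v].
- exact: tensor_refl.
- exact: tensor_sym.
- exact: tensor_trans h2.
- by rewrite /scale_pairs !map_cat; exact: tensor_cat.
- by rewrite /scale_pairs !map_cat; exact: tensor_catC.
- by rewrite /scale_pairs /= scaler0; exact: tensor_zero.
- by rewrite /scale_pairs /= scalerDr; exact: tensor_addl.
- exact: tensor_addr.
- by rewrite /scale_pairs /= scalerA mulrC -scalerA; exact: tensor_bal.
Qed.

Lemma scale_pairsD k l s :
  tensor_rel (scale_pairs (k + l) s) (scale_pairs k s ++ scale_pairs l s).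
Proof.
elim: s => [|[u v] s ih] /=; first exact: tensor_refl.
rewrite scalerDl -cat1s.
apply: tensor_trans (tensor_cat (tensor_addl _ _ _) ih) _.
have := tensor_cat (tensor_refl [:: (k *: u, v)]) (tensor_cat
  (tensor_catC [:: (l *: u, v)] (scale_pairs k s))
  (tensor_refl (scale_pairs l s))).
by rewrite -!catA.
Qed.

Lemma scale_pairs0 s : tensor_rel (scale_pairs 0 s) [::].
Proof.
elim: s => [|[u v] s ih] /=; first exact: tensor_refl.
rewrite scale0r -cat1s -[[::]]/([::] ++ [::]).
by apply: tensor_cat ih; exact: tensor_zero.
Qed.

Lemma scale_pairs1 s : scale_pairs 1 s = s.
Proof. by elim: s => [|[u v] s ih] //=; rewrite scale1r ih. Qed.

Definition tensor0 : tensor := \pi_tensor [::].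
Definition tensorD (x y : tensor) : tensor := \pi_tensor (repr x ++ repr y).
Definition tensorZ (k : K) (x : tensor) : tensor :=
  \pi_tensor (scale_pairs k (repr x)).
Definition tensorN : tensor -> tensor := tensorZ (-1).

Lemma tensorD_pi s t : tensorD (\pi_tensor s) (\pi_tensor t) = \pi_tensor (s ++ t).
Proof. by apply/tensor_piE/tensor_cat; exact: tensor_repr_pi. Qed.

Lemma tensorZ_pi k s : tensorZ k (\pi_tensor s) = \pi_tensor (scale_pairs k s).
Proof. exact/tensor_piE/scale_pairs_rel/tensor_repr_pi. Qed.

Lemma tensorDA : associative tensorD.
Proof.
by elim/tensorW=> s; elim/tensorW=> t; elim/tensorW=> w; rewrite !tensorD_pi catA.
Qed.

Lemma tensorDC : commutative tensorD.
Proof.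
elim/tensorW=> s; elim/tensorW=> t; rewrite !tensorD_pi.
exact/tensor_piE/tensor_catC.
Qed.

Lemma tensor0D : left_id tensor0 tensorD.
Proof. by elim/tensorW=> s; rewrite tensorD_pi. Qed.

Lemma tensorND : left_inverse tensor0 tensorN tensorD.
Proof.
elim/tensorW=> s; rewrite /tensorN tensorZ_pi tensorD_pi; apply/tensor_piE.
apply: (@tensor_trans _ (scale_pairs (-1 + 1) s)).
  by apply: tensor_sym; rewrite -[X in _ ++ X]scale_pairs1; exact: scale_pairsD.
by rewrite addNr; exact: scale_pairs0.
Qed.

HB.instance Definition _ :=
  GRing.isZmodule.Build tensor tensorDA tensorDC tensor0D tensorND.

Lemma tensorZA k l x : tensorZ k (tensorZ l x) = tensorZ (k * l) x.
Proof.
elim/tensorW: x => s; rewrite !tensorZ_pi /scale_pairs -map_comp.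
by congr (\pi_tensor _); apply: eq_map => p /=; rewrite scalerA.
Qed.

Lemma tensorZ1 : left_id 1 tensorZ.
Proof. by elim/tensorW=> s; rewrite tensorZ_pi scale_pairs1. Qed.

Lemma tensorZDr : right_distributive tensorZ +%R.
Proof.
move=> k; elim/tensorW=> s; elim/tensorW=> t.
rewrite [X in tensorZ k X]tensorD_pi !tensorZ_pi.
by rewrite [RHS]tensorD_pi /scale_pairs map_cat.
Qed.

Lemma tensorZDl x : {morph tensorZ^~ x : k l / k + l}.
Proof.
move=> k l; elim/tensorW: x => s; rewrite !tensorZ_pi [RHS]tensorD_pi.
exact/tensor_piE/scale_pairsD.
Qed.

HB.instance Definition _ := GRing.Zmodule_isLmodule.Build K tensor
  tensorZA tensorZ1 tensorZDr tensorZDl.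

Definition tens (u : U) (v : V) : tensor := \pi_tensor [:: (u, v)].

(** The extension to [tensor] of a map [f] of two variables; it is meaningful
    for bilinear [f], when it does not depend on the chosen representative
    (see [tsum_tens] and [tsum_linear]). *)
Definition tsum (W : lmodType K) (f : U -> V -> W) (t : tensor) : W :=
  \sum_(p <- repr t) f p.1 p.2.

End TensorProduct.

Notation "u \ox v" := (tens u v) : ring_scope.
Arguments tensor {K} U V.

Section TensorTheory.
Variable K : fieldType.
Implicit Types U V W : lmodType K.

Lemma tens_bilinear U V : bilinear_for *:%R *:%R (@tens K U V).
Proof.
have addl (u u' : U) (v : V) : (u + u') \ox v = u \ox v + u' \ox v.
  by rewrite [RHS]tensorD_pi; exact/tensor_piE/tensor_addl.
have addr (u : U) (v v' : V) : u \ox (v + v') = u \ox v + u \ox v'.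
  by rewrite [RHS]tensorD_pi; exact/tensor_piE/tensor_addr.
have sc k (u : U) (v : V) : (k *: u) \ox v = k *: (u \ox v).
  by rewrite [RHS]tensorZ_pi.
split=> [v k u u'|u k v v'] /=; first by rewrite addl sc.
by rewrite addr -sc; congr (_ + _); exact/esym/tensor_piE/tensor_bal.
Qed.

Lemma tensor_sumE U V (t : tensor U V) : t = \sum_(p <- repr t) p.1 \ox p.2.
Proof.
rewrite -[LHS]reprK; elim: (repr t) => [|[u v] s ih]; first by rewrite big_nil.
by rewrite big_cons -ih [RHS]tensorD_pi.
Qed.

Section Lift.
Variables (U V W : lmodType K) (f : U -> V -> W).
Hypothesis fB : bilinear_for *:%R *:%R f.

Let fl v : linear (f^~ v). Proof. exact: fB.1. Qed.
Let fr u : linear (f u). Proof. exact: fB.2. Qed.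

Lemma tsum_pi s : tsum f (\pi_(tensor U V) s) = \sum_(p <- s) f p.1 p.2.
Proof.
have f0 v : f 0 v = 0.
  by have /= := fl v (-1) 0 0; rewrite scaler0 addr0 scaleN1r addNr.
have f0r u : f u 0 = 0.
  by have /= := fr u (-1) 0 0; rewrite scaler0 addr0 scaleN1r addNr.
rewrite /tsum; move: (repr _) (tensor_repr_pi s) => t.
elim=> {s t} [//|s t _ ->//|s t w _ -> _ ->//|s s' t t' _ h1 _ h2|s t|v|u u' v|u v v'|k u v].
- by rewrite !big_cat h1 h2.
- by rewrite !big_cat /= addrC.
- by rewrite big_seq1 big_nil f0.
- rewrite big_seq1 big_cons big_seq1 /=.
  by have /= := fl v 1 u u'; rewrite !scale1r.
- rewrite big_seq1 big_cons big_seq1 /=.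
  by have /= := fr u 1 v v'; rewrite !scale1r.
- rewrite !big_seq1 /=.
  have /= := fl v k u 0; rewrite f0 !addr0 => ->.
  by have /= := fr u k v 0; rewrite f0r !addr0.
Qed.

Lemma tsum_tens u v : tsum f (u \ox v) = f u v.
Proof. by rewrite tsum_pi big_seq1. Qed.

Lemma tsum_linear : linear (tsum f).
Proof.
move=> k; elim/tensorW=> s; elim/tensorW=> t.
rewrite [k *: _]tensorZ_pi [_ + _]tensorD_pi !tsum_pi big_cat big_map.
rewrite scaler_sumr; congr (_ + _); apply: eq_bigr => p _ /=.
have f0 : f 0 p.2 = 0.
  by have /= := fl p.2 (-1) 0 0; rewrite scaler0 addr0 scaleN1r addNr.
by have /= := fl p.2 k p.1 0; rewrite f0 !addr0.
Qed.

End Lift.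

Lemma tensor_linear_ext U V W (f g : {linear tensor U V -> W}) :
  (forall u v, f (u \ox v) = g (u \ox v)) -> f =1 g.
Proof.
move=> fg t; rewrite (tensor_sumE t) !linear_sum.
by apply: eq_bigr => p _.
Qed.

Section Tmap.
Variables (U V U' V' : lmodType K).
Variables (f : {linear U -> U'}) (g : {linear V -> V'}).

Definition tmap : tensor U V -> tensor U' V' := tsum (fun u v => f u \ox g v).

Lemma tmap_bilinear : bilinear_for *:%R *:%R (fun u v => f u \ox g v).
Proof.
have [hl hr] := tens_bilinear U' V'.
by split=> [v k u u'|u k v v'] /=; rewrite linearP ?(hl (g v)) ?(hr (f u)).
Qed.

Lemma tmap_tens u v : tmap (u \ox v) = f u \ox g v.
Proof. by rewrite /tmap tsum_tens //; exact: tmap_bilinear. Qed.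

HB.instance Definition _ := GRing.isLinear.Build K _ _ _ tmap
  (tsum_linear tmap_bilinear).
End Tmap.

Section Tassoc.
Variables (U V W : lmodType K).

(** By convention $U \otimes V \otimes W$ is [tensor U (tensor V W)]. *)
Definition tassoc : tensor (tensor U V) W -> tensor U (tensor V W) :=
  tsum (fun t w => tsum (fun u v => u \ox (v \ox w)) t).

Lemma tassoc_in_bilinear w :
  bilinear_for *:%R *:%R (fun (u : U) (v : V) => u \ox (v \ox (w : W))).
Proof.
have [hl hr] := tens_bilinear U (tensor V W).
have [hl' _] := tens_bilinear V W.
by split=> [v k u u'|u k v v'] /=; rewrite ?(hl' w) ?(hr u) ?(hl (v \ox w)).
Qed.

Lemma tassoc_bilinear : bilinear_for *:%R *:%R
  (fun t w => tsum (fun (u : U) (v : V) => u \ox (v \ox (w : W))) t).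
Proof.
split=> [w k t t'|t k w w'] /=; first exact: (tsum_linear (tassoc_in_bilinear w)).
rewrite /tsum scaler_sumr -big_split; apply: eq_bigr => p _ /=.
have [_ hr] := tens_bilinear U (tensor V W).
have [_ hr'] := tens_bilinear V W.
by rewrite (hr' p.2) (hr p.1).
Qed.

Lemma tassoc_tens u v w : tassoc ((u \ox v) \ox w) = u \ox (v \ox w).
Proof.
rewrite /tassoc (tsum_tens tassoc_bilinear).
exact: (tsum_tens (tassoc_in_bilinear w)).
Qed.

HB.instance Definition _ := GRing.isLinear.Build K _ _ _ tassoc
  (tsum_linear tassoc_bilinear).
End Tassoc.

Section LinearInverse.
Variables (U V : lmodType K) (f : {linear U -> V}).

(** The inverse of a bijective linear map. The junk value [0] for a
    non-bijective [f] makes [linv f] linear in all cases. *)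
Definition linv (y : V) : U :=
  if `[< bijective f >] then xget 0 [set x | f x = y]%classic else 0.

Lemma linvK : bijective f -> cancel linv f.
Proof.
move=> bf y; rewrite /linv; case: asboolP => // -[g _ gK].
by apply: (@xgetPex _ 0 [set x | f x = y]%classic); exists (g y); exact: gK.
Qed.

Lemma linvKV : bijective f -> cancel f linv.
Proof. by move=> bf x; apply: (bij_inj bf); rewrite linvK. Qed.

Lemma linv_linear : linear linv.
Proof.
move=> k x y; have [bf|nbf] := pselect (bijective f).
  by apply: (bij_inj bf); rewrite linearP !linvK.
by rewrite /linv; case: asboolP => // _; rewrite scaler0 addr0.
Qed.

HB.instance Definition _ := GRing.isLinear.Build K _ _ _ linv linv_linear.
End LinearInverse.

End TensorTheory.

Section BiHomStructures.
Variables (K : fieldType) (A : lmodType K).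

Definition commuting (f g : A -> A) : Prop := f \o g =1 g \o f.

Definition multiplicative_for (mu : {linear tensor A A -> A}) (f : A -> A) : Prop :=
  forall a b, f (mu (a \ox b)) = mu (f a \ox f b).

Definition comultiplicative_for (D : {linear A -> tensor A A})
    (f : {linear A -> A}) : Prop :=
  forall a, tmap f f (D a) = D (f a).

Definition invariant_tensor (f : {linear A -> A}) (r : tensor A A) : Prop :=
  tmap f f r = r.

Record bihom_associative (mu : {linear tensor A A -> A})
    (alpha beta : {linear A -> A}) : Prop := BiHomAssociative {
  bha_comm : commuting alpha beta;
  bha_alpha : multiplicative_for mu alpha;
  bha_beta : multiplicative_for mu beta;
  bha_assoc : forall a b c,
    mu (alpha a \ox mu (b \ox c)) = mu (mu (a \ox b) \ox beta c) }.

Record bihom_coassociative (D : {linear A -> tensor A A})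
    (psi omega : {linear A -> A}) : Prop := BiHomCoassociative {
  bhc_comm : commuting psi omega;
  bhc_psi : comultiplicative_for D psi;
  bhc_omega : comultiplicative_for D omega;
  bhc_coassoc : forall a,
    tassoc (tmap D psi (D a)) = tmap omega D (D a) }.

Variables (mu : {linear tensor A A -> A}) (alpha beta psi omega : {linear A -> A}).

(** $a \triangleright t$ is [ltri a t] and $t \triangleleft a$ is [rtri t a]. *)
Definition ltri (a : A) (t : tensor A A) : tensor A A :=
  tsum (fun x y => mu (omega a \ox x) \ox beta y) t.

Definition rtri (t : tensor A A) (a : A) : tensor A A :=
  tsum (fun x y => alpha x \ox mu (y \ox psi a)) t.

(** The products $r_{12}s_{23}$, $r_{13}s_{12}$ and $r_{23}s_{13}$. *)
Definition leg12_23 (r s : tensor A A) : tensor A (tensor A A) :=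
  tsum (fun r1 r2 => tsum (fun s1 s2 =>
    alpha r1 \ox (mu (r2 \ox s1) \ox beta s2)) s) r.

Definition leg13_12 (r s : tensor A A) : tensor A (tensor A A) :=
  tsum (fun r1 r2 => tsum (fun s1 s2 =>
    mu (omega r1 \ox s1) \ox (beta s2 \ox alpha (psi r2))) s) r.

Definition leg23_13 (r s : tensor A A) : tensor A (tensor A A) :=
  tsum (fun r1 r2 => tsum (fun s1 s2 =>
    beta (omega s1) \ox (alpha r1 \ox mu (r2 \ox psi s2))) s) r.

Record bihom_derivation (d : {linear A -> tensor A A}) : Prop := BiHomDerivation {
  bhd_alpha : comultiplicative_for d alpha;
  bhd_beta : comultiplicative_for d beta;
  bhd_psi : comultiplicative_for d psi;
  bhd_omega : comultiplicative_for d omega;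
  bhd_leibniz : forall a b,
    d (mu (a \ox b)) = ltri a (d b) + rtri (d a) b }.

Record covariant_bihom_bialgebra (d1 d2 D : {linear A -> tensor A A}) : Prop :=
    CovariantBiHomBialgebra {
  cbb_d1 : bihom_derivation d1;
  cbb_d2 : bihom_derivation d2;
  cbb_algebra : bihom_associative mu alpha beta;
  cbb_coalgebra : bihom_coassociative D psi omega;
  cbb_cov1 : forall a b,
    D (mu (a \ox b)) = rtri (D a) b + ltri a (d1 b);
  cbb_cov2 : forall a b,
    D (mu (a \ox b)) = ltri a (D b) + rtri (d2 a) b;
  cbb_psi_alpha : commuting psi alpha;
  cbb_psi_beta : commuting psi beta;
  cbb_omega_alpha : commuting omega alpha;
  cbb_omega_beta : commuting omega beta;
  cbb_D_alpha : comultiplicative_for D alpha;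
  cbb_D_beta : comultiplicative_for D beta;
  cbb_psi_mult : multiplicative_for mu psi;
  cbb_omega_mult : multiplicative_for mu omega }.

(** [codiff r s] is $a \mapsto \alpha^{-1}(a) \triangleright r
    - s \triangleleft \beta^{-1}(a)$, so that $\delta_r$, $\delta_s$ and
    $\Delta$ are [codiff r r], [codiff s s] and [codiff r s]. *)
Definition codiff (r s : tensor A A) (a : A) : tensor A A :=
  ltri (linv alpha a) r - rtri s (linv beta a).

Lemma codiff_linear r s : linear (codiff r s).
Proof.
have [hl hr] := tens_bilinear A A.
have hL : linear (ltri^~ r).
  move=> k a b; rewrite /ltri /tsum scaler_sumr -big_split.
  by apply: eq_bigr => p _ /=; rewrite linearP (hl p.1) linearP (hl (beta p.2)).
have hR : linear (rtri s).
  move=> k a b; rewrite /rtri /tsum scaler_sumr -big_split.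
  by apply: eq_bigr => p _ /=; rewrite linearP (hr p.2) linearP (hr (alpha p.1)).
move=> k a b; rewrite /codiff !linearP hL hR scalerBr.
by rewrite opprD addrACA.
Qed.

HB.instance Definition _ r s := GRing.isLinear.Build K _ _ _ (codiff r s)
  (codiff_linear r s).

Definition assoc_bihom_YB_pair (r s : tensor A A) : Prop :=
  leg13_12 r r - leg12_23 r r + leg23_13 s r = 0 /\
  leg13_12 s r - leg12_23 s s + leg23_13 s s = 0.

(** The Yang-Baxter equations imply the first conjunct when [r] and [s] are
    invariant and the structure maps are compatible; it is required outright so
    that [quasitriangular] always refers to a covariant BiHom-bialgebra. *)
Definition quasitriangular (r s : tensor A A) : Prop :=
  covariant_bihom_bialgebra (codiff r r) (codiff s s) (codiff r s) /\
  assoc_bihom_YB_pair r s.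

End BiHomStructures.

(* Main.v *)
Require Import Defs.
From HB Require Import structures.
From mathcomp Require Import all_boot all_algebra sesquilinear.
Import GRing.Theory.
Local Open Scope ring_scope.
Set Implicit Arguments.
Unset Strict Implicit.
Unset Printing Implicit Defensive.

(** Write $\Delta = L_r - R_s$ with $L_r(a) = \alpha^{-1}(a) \triangleright r$
    and $R_s(a) = s \triangleleft \beta^{-1}(a)$.

    Invariance lets a structure map (or its inverse) be moved from one leg of
    $r$ or $s$ to the other. After such moves, evaluating $\Delta$ on one leg
    gives
    $(\omega \otimes \Delta)(r) = r_{12}r_{23} - s_{23}r_{13}$ and
    $(\Delta \otimes \psi)(s) = s_{13}r_{12} - s_{12}s_{23}$
    ([tmap_codiff_r], [tassoc_codiff_s]). So the two identities of the theorem
    are the two Yang-Baxter equations of weight $(0,0)$ with their terms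
    rearranged ([leg_YB_pairP]), which settles one direction.

    For the other direction the bialgebra axioms have to be derived. The rules
    $L_r(ab) = a \triangleright L_r(b)$, $R_s(ab) = R_s(a) \triangleleft b$ and
    $a \triangleright R_t(b) = L_t(a) \triangleleft b$ give every Leibniz-type
    rule by cancelling one term. Coassociativity is where the two identities
    enter. Let $\lambda_a$ and $\rho_a$ be the extensions of the two actions to
    the outer legs of $A \otimes A \otimes A$. Then
    $(\omega \otimes \Delta)L_r(a) = \lambda_a((\omega \otimes \Delta)(r))$ and
    $(\Delta \otimes \psi)R_s(a) = \rho_a((\Delta \otimes \psi)(s))$, while
    $(\Delta \otimes \psi)L_r(a) = \lambda_a(r_{13}r_{12}) - M_a$ and
    $(\omega \otimes \Delta)R_s(a) = M_a - \rho_a(s_{23}s_{13})$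
    with the same middle term $M_a$, the product of $s_{12}$, $a$ and $r_{23}$.
    Substituting the two identities makes both sides of coassociativity equal to
    $\lambda_a(r_{13}r_{12}) - M_a + \rho_a(s_{23}s_{13})$. *)

(** * Sums over tensors *)

Section TensorSums.
Variable K : fieldType.
Implicit Types U V W X Y Z : lmodType K.

Lemma tens_linearl U V (v : V) : linear (fun u : U => u \ox v).
Proof. exact: (tens_bilinear U V).1. Qed.

Lemma tens_linearr U V (u : U) : linear (fun v : V => u \ox v).
Proof. exact: (tens_bilinear U V).2. Qed.

HB.instance Definition _ U V (u : U) :=
  GRing.isLinear.Build K V (tensor U V) _ (tens u) (tens_linearr u).

Lemma eq_tsum U V W (f g : U -> V -> W) t : f =2 g -> tsum f t = tsum g t.
Proof. by move=> fg; apply: eq_bigr => p _. Qed.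

Lemma linear_tsum U V W X (h : {linear W -> X}) (f : U -> V -> W) t :
  h (tsum f t) = tsum (fun u v => h (f u v)) t.
Proof. exact: linear_sum. Qed.

Lemma tens_tsuml U V W X (f : U -> V -> W) t (x : X) :
  tsum f t \ox x = tsum (fun u v => f u v \ox x) t.
Proof.
pose h : {linear W -> tensor W X} :=
  HB.pack (fun w => w \ox x) (GRing.isLinear.Build K _ _ _ _ (tens_linearl x)).
exact: (linear_tsum h).
Qed.

Lemma tsum_sub U V W (f g : U -> V -> W) t :
  tsum (fun u v => f u v - g u v) t = tsum f t - tsum g t.
Proof. exact: sumrB. Qed.

Lemma exchange_tsum U V X Y W (f : U -> V -> X -> Y -> W) t w :
  tsum (fun u v => tsum (f u v) w) t =
  tsum (fun x y => tsum (fun u v => f u v x y) t) w.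
Proof. exact: exchange_big. Qed.

(** The universal property of the tensor product, as a bundled linear map. *)
Definition tlift U V W (f : U -> V -> W) (fB : bilinear_for *:%R *:%R f) :
    {linear tensor U V -> W} :=
  HB.pack (tsum f) (GRing.isLinear.Build K _ _ _ _ (tsum_linear fB)).

Lemma tsumB U V W (f : U -> V -> W) t t' : bilinear_for *:%R *:%R f ->
  tsum f (t - t') = tsum f t - tsum f t'.
Proof. by move=> fB; exact: (linearB (tlift fB)). Qed.

Lemma tsum_tsum U V X Y W (f : X -> Y -> W) (g : U -> V -> X)
    (h : U -> V -> Y) t :
  bilinear_for *:%R *:%R f ->
  tsum f (tsum (fun u v => g u v \ox h u v) t) =
  tsum (fun u v => f (g u v) (h u v)) t.
Proof.
move=> fB; rewrite [LHS](linear_tsum (tlift fB)).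
by apply: eq_tsum => u v; exact: tsum_tens.
Qed.

Lemma tmap_tsum U V W X Y Z (f : {linear X -> W}) (g : {linear Y -> Z})
    (h : U -> V -> X) (h' : U -> V -> Y) t :
  tmap f g (tsum (fun u v => h u v \ox h' u v) t) =
  tsum (fun u v => f (h u v) \ox g (h' u v)) t.
Proof. by rewrite linear_tsum; apply: eq_tsum => u v; exact: tmap_tens. Qed.

Lemma tassoc_tsum U V W X Y (f : U -> V -> X) (g : U -> V -> Y) t (w : W) :
  tassoc (tsum (fun u v => f u v \ox g u v) t \ox w) =
  tsum (fun u v => f u v \ox (g u v \ox w)) t.
Proof.
by rewrite tens_tsuml linear_tsum; apply: eq_tsum => u v; exact: tassoc_tens.
Qed.

Lemma tensBl U V (u u' : U) (v : V) : (u - u') \ox v = u \ox v - u' \ox v.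
Proof.
by have := tens_linearl v (-1) u' u; rewrite /= !scaleN1r ![- _ + _]addrC.
Qed.

(** Naturality of the associator, on tensors that are pure in the last leg. *)
Lemma tassoc_tmap U V W X Y Z (f : {linear U -> X}) (g : {linear V -> Y})
    (h : {linear W -> Z}) t w :
  tassoc (tmap f g t \ox h w) = tmap f (tmap g h) (tassoc (t \ox w)).
Proof.
rewrite [in RHS](tensor_sumE t) -/(tsum (fun u v => u \ox v) t).
rewrite !tassoc_tsum tmap_tsum.
by apply: eq_tsum => u v; rewrite /= tmap_tens.
Qed.

(** The form in which invariance is used: inside a bilinear expression, [F] can
    be inserted on both legs of [t]. The function [g] is left free because the
    expression wanted is [f (F u) (F v)] only after the structure maps have been
    commuted past each other. *)
Lemma tsum_invariant U W (F : {linear U -> U}) (f g : U -> U -> W) t :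
  invariant_tensor F t -> bilinear_for *:%R *:%R f ->
  (forall u v, g u v = f (F u) (F v)) -> tsum f t = tsum g t.
Proof.
by move=> Ft fB gE; rewrite -{1}Ft /tmap tsum_tsum //; apply: eq_tsum => u v.
Qed.

(** Trades one structure map for another on the legs of [t]; this is how an
    inverse such as $\alpha^{-1}$ disappears from one leg in exchange for
    $\alpha$ on the other. *)
Lemma tsum_shift U W (F G : {linear U -> U}) (f g h : U -> U -> W) t :
  invariant_tensor F t -> invariant_tensor G t -> bilinear_for *:%R *:%R f ->
  (forall u v, g u v = f (F u) (F v)) -> (forall u v, h u v = f (G u) (G v)) ->
  tsum g t = tsum h t.
Proof.
move=> Ft Gt fB gE hE.
by rewrite -(tsum_invariant Ft fB gE) (tsum_invariant Gt fB hE).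
Qed.

End TensorSums.

Ltac bilin :=
  let k := fresh in let x := fresh in let y := fresh in let z := fresh in
  split=> [z k x y|z k x y] /=; rewrite !(linearP, tens_linearl); reflexivity.

(** * Rules for the structure maps and the two actions *)

Lemma commuting_linv (K : fieldType) (A : lmodType K) (f : {linear A -> A})
    (g : A -> A) :
  bijective f -> commuting f g -> commuting (linv f) g.
Proof.
move=> bf fg a; apply: (bij_inj bf).
by rewrite /= linvK // [RHS](fg (linv f a)) /= linvK.
Qed.

Lemma commuting_sym (K : fieldType) (A : lmodType K) (f g : A -> A) :
  commuting f g -> commuting g f.
Proof. by move=> fg a; rewrite [RHS]fg. Qed.

Section Codifferential.
Variables (K : fieldType) (A : lmodType K) (mu : {linear tensor A A -> A})
  (alpha beta psi omega : {linear A -> A}).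
Hypothesis bij_alpha : bijective alpha.
Hypothesis bij_beta : bijective beta.
Hypothesis hA : bihom_associative mu alpha beta.
Hypothesis alpha_psi : commuting alpha psi.
Hypothesis alpha_omega : commuting alpha omega.
Hypothesis beta_psi : commuting beta psi.
Hypothesis beta_omega : commuting beta omega.
Hypothesis psi_omega : commuting psi omega.
Hypothesis psi_mult : multiplicative_for mu psi.
Hypothesis omega_mult : multiplicative_for mu omega.

Local Notation a' := (linv alpha).
Local Notation b' := (linv beta).
Local Notation "x ⋅ y" := (mu (x \ox y)) 
  (at level 33, left associativity).
Local Notation "a ▷ t" := (ltri mu beta omega a t) 
  (at level 38, right associativity).
Local Notation "t ◁ a" := (rtri mu alpha psi t a) 
  (at level 39, left associativity).
Local Notation codiff := (codiff mu alpha beta psi omega).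
Local Notation leg12_23 := (leg12_23 mu alpha beta).
Local Notation leg13_12 := (leg13_12 mu alpha beta psi omega).
Local Notation leg23_13 := (leg23_13 mu alpha beta psi omega).

Let alpha_beta := bha_comm hA.
Let alphaM := bha_alpha hA.
Let betaM := bha_beta hA.
Let assoc := bha_assoc hA.


Lemma linv_mult (f : {linear A -> A}) : bijective f -> multiplicative_for mu f ->
  multiplicative_for mu (linv f).
Proof. by move=> bf fM a b; apply: (bij_inj bf); rewrite fM !linvK. Qed.
Let alphaVM := linv_mult bij_alpha alphaM.
Let betaVM := linv_mult bij_beta betaM.

(** Rewriting with these rules brings a word in the structure maps and the two
    inverses to a normal form, in the order
    $\alpha, \beta, \psi, \omega$ from the outside in, and cancels inverses. *)
Lemma commE : ((forall x, beta (alpha x) = alpha (beta x)) *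
  (forall x, psi (alpha x) = alpha (psi x)) *
  (forall x, omega (alpha x) = alpha (omega x)) *
  (forall x, psi (beta x) = beta (psi x)) *
  (forall x, omega (beta x) = beta (omega x)) *
  (forall x, omega (psi x) = psi (omega x)) *
  (forall x, b' (alpha x) = alpha (b' x)) *
  (forall x, beta (a' x) = a' (beta x)) *
  (forall x, psi (a' x) = a' (psi x)) *
  (forall x, omega (a' x) = a' (omega x)) *
  (forall x, psi (b' x) = b' (psi x)) *
  (forall x, omega (b' x) = b' (omega x)) *
  (forall x, b' (a' x) = a' (b' x)) *
  (cancel a' alpha) * cancel alpha a' * cancel b' beta * cancel beta b')%type.
Proof.
have aB : commuting a' beta by apply: commuting_linv.
have bA : commuting b' alpha.
  by apply: commuting_linv => //; exact: commuting_sym.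
have aP : commuting a' psi by apply: commuting_linv.
have aO : commuting a' omega by apply: commuting_linv.
have bP : commuting b' psi by apply: commuting_linv.
have bO : commuting b' omega by apply: commuting_linv.
have ab : commuting b' a'.
  by apply: commuting_linv => //; exact: commuting_sym.
do ![apply: pair] => x; rewrite ?linvK ?linvKV //.
all: solve [exact: bA | exact: ab | symmetry;
  solve [ exact: alpha_beta | exact: alpha_psi | exact: alpha_omega
        | exact: beta_psi | exact: beta_omega | exact: psi_omega
        | exact: aB | exact: aP | exact: aO | exact: bP | exact: bO ]].
Qed.

Lemma ltri_ltri t a b :
  a ▷ b ▷ t = tsum (fun x y => omega a ⋅ (omega b ⋅ x) \ox beta (beta y)) t.
Proof. by rewrite /ltri tsum_tsum //; bilin. Qed.

Lemma rtri_rtri t a b :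
  t ◁ a ◁ b = tsum (fun x y => alpha (alpha x) \ox (y ⋅ psi a) ⋅ psi b) t.
Proof. by rewrite /rtri tsum_tsum //; bilin. Qed.

(** [a ▷ -] is not an action of [A] on the nose: BiHom-associativity costs one
    $\beta$ on the first leg, which invariance of [t] supplies. *)
Lemma ltri_mul t a b : invariant_tensor beta t -> a' (a ⋅ b) ▷ t = a ▷ a' b ▷ t.
Proof.
move=> tb; rewrite ltri_ltri.
apply: (tsum_invariant tb) => [|x y]; first by bilin.
by rewrite alphaVM omega_mult -assoc !commE.
Qed.

Lemma rtri_mul t a b : invariant_tensor alpha t -> t ◁ b' (a ⋅ b) = t ◁ b' a ◁ b.
Proof.
move=> ta; rewrite rtri_rtri.
apply: (tsum_invariant ta) => [|x y]; first by bilin.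
by rewrite betaVM psi_mult assoc !commE.
Qed.

(** Both sides are $\omega(a)\alpha(t^1) \otimes \beta(t^2)\psi(b)$. *)
Lemma ltri_rtri t a b : a ▷ (t ◁ b' b) = (a' a ▷ t) ◁ b.
Proof.
rewrite /ltri /rtri !tsum_tsum; try by bilin.
by apply: eq_tsum => x y; rewrite alphaM betaM !commE.
Qed.

Implicit Types (r s t : tensor A A) (a b : A).

Lemma ltriB a t t' : a ▷ (t - t') = a ▷ t - a ▷ t'.
Proof. by rewrite /ltri tsumB //; bilin. Qed.

Lemma rtriB a t t' : (t - t') ◁ a = t ◁ a - t' ◁ a.
Proof. by rewrite /rtri tsumB //; bilin. Qed.

(** * Leibniz rules and compatibility with the structure maps *)

Lemma codiff_mul r s a b : invariant_tensor beta r -> invariant_tensor alpha s ->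
  codiff r s (a ⋅ b) = a ▷ a' b ▷ r - s ◁ b' a ◁ b.
Proof. by move=> rb sa; rewrite /Defs.codiff ltri_mul // rtri_mul. Qed.

(** By [ltri_rtri], the term $a \triangleright (r \triangleleft \beta^{-1}(b))$
    of the second summand cancels the left half of the first. *)
Lemma codiff_mulr r s a b : invariant_tensor beta r -> invariant_tensor alpha s ->
  codiff r s (a ⋅ b) = codiff r s a ◁ b + a ▷ codiff r r b.
Proof.
move=> rb sa; rewrite codiff_mul // /Defs.codiff ltriB rtriB ltri_rtri.
by rewrite [RHS]addrC addrA subrK.
Qed.

Lemma codiff_mull r s a b : invariant_tensor beta r -> invariant_tensor alpha s ->
  codiff r s (a ⋅ b) = a ▷ codiff r s b + codiff s s a ◁ b.
Proof.
move=> rb sa; rewrite codiff_mul // /Defs.codiff ltriB rtriB ltri_rtri.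
by rewrite addrA subrK.
Qed.

Section StructureMap.
Variable F : {linear A -> A}.
Hypotheses (FM : multiplicative_for mu F) (Fa : commuting alpha F)
  (Fb : commuting beta F) (Fp : commuting psi F) (Fo : commuting omega F).

Lemma tmap_ltri a t : tmap F F (a ▷ t) = F a ▷ tmap F F t.
Proof.
rewrite /ltri tmap_tsum tsum_tsum; last by bilin.
by apply: eq_tsum => x y; rewrite FM -[F (omega a)]Fo -[F (beta y)]Fb.
Qed.

Lemma tmap_rtri a t : tmap F F (t ◁ a) = tmap F F t ◁ F a.
Proof.
rewrite /rtri tmap_tsum tsum_tsum; last by bilin.
by apply: eq_tsum => x y; rewrite FM -[F (alpha x)]Fa -[F (psi a)]Fp.
Qed.

Lemma codiff_comult r s : invariant_tensor F r -> invariant_tensor F s ->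
  comultiplicative_for (codiff r s) F.
Proof.
move=> rF sF a; rewrite /= /Defs.codiff linearB /= tmap_ltri tmap_rtri rF sF.
rewrite -[F (a' a)](commuting_linv bij_alpha Fa).
by rewrite -[F (b' a)](commuting_linv bij_beta Fb).
Qed.
End StructureMap.

Lemma codiff_derivation t : invariant_tensor alpha t -> invariant_tensor beta t ->
    invariant_tensor psi t -> invariant_tensor omega t ->
  bihom_derivation mu alpha beta psi omega (codiff t t).
Proof.
move=> t_alpha t_beta t_psi t_omega.
split=> [||||a b]; last exact: codiff_mull.
all: by apply: codiff_comult => //; exact: commuting_sym.
Qed.


(** * The two identities as Yang-Baxter equations *)

Section Pair.
Variables r s : tensor A A.
Hypotheses (r_alpha : invariant_tensor alpha r) (r_beta : invariant_tensor beta r)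
    (r_psi : invariant_tensor psi r) (r_omega : invariant_tensor omega r)
    (s_alpha : invariant_tensor alpha s) (s_beta : invariant_tensor beta s)
    (s_psi : invariant_tensor psi s) (s_omega : invariant_tensor omega s).
Local Notation D := (codiff r s).

Lemma tmap_codiff_r :
  tmap omega D r = leg12_23 r r - leg23_13 s r.
Proof.
rewrite {1}/tmap /= /Defs.codiff.
under [LHS]eq_tsum => x y do rewrite linearB.
rewrite tsum_sub; congr (_ - _).
  under [LHS]eq_tsum => x y do rewrite linear_tsum /=.
  rewrite [LHS]exchange_tsum [RHS]exchange_tsum; apply: eq_tsum => u v.
  (* The copy of $r$ with legs [x], [y] trades $\omega$ for $\alpha$. *)
  apply: (tsum_shift (f := fun x y => x \ox (a' y ⋅ u \ox beta v))
    r_omega r_alpha).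
  - by bilin.
  - by move=> x y; rewrite ?commE.
  - by move=> x y; rewrite ?commE.
under [LHS]eq_tsum => x y do rewrite linear_tsum /=.
rewrite [LHS]exchange_tsum; apply: eq_tsum => u v.
apply: (tsum_invariant r_beta) => [|x y]; first by bilin.
by rewrite /= ?commE.
Qed.

Lemma tassoc_codiff_s :
  tassoc (tmap D psi s) = leg13_12 s r - leg12_23 s s.
Proof.
rewrite {1}/tmap /= /Defs.codiff linear_tsum.
under [LHS]eq_tsum => x y do rewrite /= tensBl linearB.
rewrite tsum_sub; congr (_ - _).
  under [LHS]eq_tsum => x y do rewrite /= tassoc_tsum.
  rewrite [LHS]exchange_tsum [RHS]exchange_tsum; apply: eq_tsum => u v.
  apply: (tsum_invariant s_alpha) => [|x y]; first by bilin.
  by rewrite /= ?commE.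
under [LHS]eq_tsum => x y do rewrite /= tassoc_tsum.
rewrite [LHS]exchange_tsum; apply: eq_tsum => u v.
apply: (tsum_shift (f := fun x y => alpha u \ox (v ⋅ b' x \ox y))
  s_psi s_beta).
- by bilin.
- by move=> x y; rewrite ?commE.
- by move=> x y; rewrite ?commE.
Qed.

Lemma leg_YB_pairP : assoc_bihom_YB_pair mu alpha beta psi omega r s <->
  tmap omega D r = leg13_12 r r /\ tassoc (tmap D psi s) = - leg23_13 s s.
Proof.
rewrite tmap_codiff_r tassoc_codiff_s /assoc_bihom_YB_pair.
set y := leg23_13 s r.
rewrite -[_ - _ + y]addrA [- _ + y]addrC -opprB.
by split=> -[/eqP h1 /eqP h2]; split; apply/eqP; move: h1 h2;
  rewrite ?subr_eq0 ?addr_eq0 // eq_sym.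
Qed.

(** * Coassociativity *)

Lemma rmul_linear y : linear (fun x => x ⋅ y).
Proof. by move=> k x z; rewrite tens_linearl linearP. Qed.

Definition rmul y : {linear A -> A} :=
  HB.pack (fun x => x ⋅ y) (GRing.isLinear.Build K _ _ _ _ (rmul_linear y)).

(** The left action on the first leg of a triple tensor, with $\beta$ on the other
    two legs; with [c = omega (alpha^-1 a)] this is $\lambda_a$. Mirrored,
    [rtri3] acts on the last leg and gives $\rho_a$. *)
Definition ltri3 c : {linear tensor A (tensor A A) -> tensor A (tensor A A)} :=
  tmap (mu \o tens (omega c)) (tmap beta beta).

Definition rtri3 c : {linear tensor A (tensor A A) -> tensor A (tensor A A)} :=
  tmap alpha (tmap alpha (rmul (psi c))).

Let D_alpha : comultiplicative_for D alpha.
Proof. exact: codiff_comult. Qed.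
Let D_beta : comultiplicative_for D beta.
Proof. by apply: codiff_comult => //; exact: commuting_sym. Qed.

Lemma tmap_codiff_ltri c :
  tmap omega D (c ▷ r) = ltri3 (omega c) (tmap omega D r).
Proof.
rewrite /ltri tmap_tsum [in RHS]linear_tsum.
by apply: eq_tsum => x y; rewrite /= tmap_tens /= D_beta omega_mult.
Qed.

Lemma tassoc_codiff_rtri c :
  tassoc (tmap D psi (s ◁ c)) = rtri3 (psi c) (tassoc (tmap D psi s)).
Proof.
rewrite /rtri tmap_tsum linear_tsum.
rewrite [tassoc (tmap _ _ _)]linear_tsum [RHS]linear_tsum.
by apply: eq_tsum => x y; rewrite /= -tassoc_tmap D_alpha psi_mult.
Qed.

(** The middle term $M_a$: the product of $s_{12}$, $a$ and $r_{23}$, where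
    [a] enters as $\psi\beta^{-1}\omega\alpha^{-1}(a)$. *)
Definition sandwich a :=
  tsum (fun u v => tsum (fun x y => alpha (alpha x) \ox
    ((y ⋅ psi (b' (omega (a' a)))) ⋅ u \ox beta v)) s) r.

(** [sandwich] as it arises when $\Delta$ is applied to the left leg of
    $L_r(a)$. *)
Lemma sandwich_rtri a :
  tsum (fun x y => tassoc ((s ◁ b' (omega (a' a)) ◁ x) \ox psi (beta y))) r =
  sandwich a.
Proof.
under [LHS]eq_tsum => x y do rewrite rtri_rtri tassoc_tsum.
rewrite [LHS]exchange_tsum [RHS]exchange_tsum; apply: eq_tsum => u v; symmetry.
apply: (tsum_invariant r_psi) => [|x y]; first by bilin.
by rewrite ?commE.
Qed.

(** [sandwich] as it arises when $\Delta$ is applied to the right leg of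
    $R_s(a)$. *)
Lemma sandwich_ltri a :
  tsum (fun x y => omega (alpha x) \ox (a' (y ⋅ psi (b' a)) ▷ r)) s = sandwich a.
Proof.
under [LHS]eq_tsum => x y do rewrite linear_tsum /=.
rewrite [LHS]exchange_tsum; apply: eq_tsum => u v.
apply: (tsum_shift (f := fun x y => alpha x \ox
  ((a' y ⋅ psi (b' (omega (a' a)))) ⋅ u \ox beta v)) s_omega s_alpha).
- by bilin.
- by move=> x y; rewrite alphaVM omega_mult ?commE.
- by move=> x y; rewrite ?commE.
Qed.

Lemma tassoc_codiff_ltri a : tassoc (tmap D psi (a' a ▷ r)) =
  ltri3 (omega (a' a)) (leg13_12 r r) - sandwich a.
Proof.
rewrite -sandwich_rtri {1}/ltri tmap_tsum linear_tsum.
under [LHS]eq_tsum => x y do rewrite /= codiff_mul // tensBl linearB.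
rewrite tsum_sub; congr (_ - _).
rewrite linear_tsum.
under [LHS]eq_tsum => x y do rewrite /= ltri_ltri tassoc_tsum.
under [RHS]eq_tsum => x y do rewrite linear_tsum /=.
rewrite [LHS]exchange_tsum [RHS]exchange_tsum; apply: eq_tsum => u v.
apply: (tsum_invariant r_alpha) => [|x y]; first by bilin.
by rewrite /= tmap_tens /= tmap_tens /= ?commE.
Qed.

Lemma tmap_codiff_rtri a : tmap omega D (s ◁ b' a) =
  sandwich a - rtri3 (psi (b' a)) (leg23_13 s s).
Proof.
rewrite -sandwich_ltri {1}/rtri tmap_tsum.
under [LHS]eq_tsum => x y do rewrite /= codiff_mul // linearB.
rewrite tsum_sub; congr (_ - _).
  by apply: eq_tsum => x y; rewrite ltri_mul.
rewrite linear_tsum.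
under [LHS]eq_tsum => x y do rewrite rtri_rtri linear_tsum /=.
under [RHS]eq_tsum => x y do rewrite linear_tsum /=.
rewrite [LHS]exchange_tsum; apply: eq_tsum => u v.
apply: (tsum_invariant s_beta) => [|x y]; first by bilin.
by rewrite /= tmap_tens /= tmap_tens /= ?commE.
Qed.

Lemma codiff_coassoc a :
  tmap omega D r = leg13_12 r r ->
  tassoc (tmap D psi s) = - leg23_13 s s ->
  tassoc (tmap D psi (D a)) = tmap omega D (D a).
Proof.
move=> h1 h2; rewrite [D a]/(a' a ▷ r - s ◁ b' a) !linearB /=.
rewrite tmap_codiff_ltri tassoc_codiff_ltri tmap_codiff_rtri.
rewrite tassoc_codiff_rtri h1 h2.
by rewrite linearN opprK opprB [LHS]addrAC addrA.
Qed.

(** * The bialgebra structure *)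

Lemma codiff_bialgebra :
  tmap omega D r = leg13_12 r r ->
  tassoc (tmap D psi s) = - leg23_13 s s ->
  covariant_bihom_bialgebra mu alpha beta psi omega (codiff r r) (codiff s s) D.
Proof.
move=> h1 h2.
have D_psi : comultiplicative_for D psi.
  by apply: codiff_comult => //; exact: commuting_sym.
have D_omega : comultiplicative_for D omega.
  by apply: codiff_comult => //; exact: commuting_sym.
split=> //; try exact: codiff_derivation; try exact: commuting_sym.
- by split=> // a; exact: codiff_coassoc.
- by move=> a b; exact: codiff_mulr.
- by move=> a b; exact: codiff_mull.
Qed.

End Pair.
End Codifferential.

Theorem theorem2p31 (K : fieldType) (A : lmodType K)
    (mu : {linear tensor A A -> A}) (alpha beta psi omega : {linear A -> A})
    (r s : tensor A A)
    (hA : bihom_associative mu alpha beta)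
    (alpha_bij : bijective alpha) (beta_bij : bijective beta)
    (alpha_beta : commuting alpha beta) (alpha_psi : commuting alpha psi)
    (alpha_omega : commuting alpha omega) (beta_psi : commuting beta psi)
    (beta_omega : commuting beta omega) (psi_omega : commuting psi omega)
    (psi_mult : multiplicative_for mu psi)
    (omega_mult : multiplicative_for mu omega)
    (r_alpha : invariant_tensor alpha r) (r_beta : invariant_tensor beta r)
    (r_psi : invariant_tensor psi r) (r_omega : invariant_tensor omega r)
    (s_alpha : invariant_tensor alpha s) (s_beta : invariant_tensor beta s)
    (s_psi : invariant_tensor psi s) (s_omega : invariant_tensor omega s) :
  quasitriangular mu alpha beta psi omega r s <->
  (tmap omega (codiff mu alpha beta psi omega r s) r
     = leg13_12 mu alpha beta psi omega r r /\
   tassoc (tmap (codiff mu alpha beta psi omega r s) psi s)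
     = - leg23_13 mu alpha beta psi omega s s).
Proof.
have YB := leg_YB_pairP alpha_bij beta_bij hA alpha_psi alpha_omega beta_psi
  beta_omega psi_omega r_alpha r_beta r_omega s_alpha s_beta s_psi.
split=> [[_ /YB]//|h]; split; last exact/YB.
by case: h => h1 h2; exact: codiff_bialgebra.
Qed.
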